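(* Let $0<x_0<x_1<1$, $0<y_0<y_1<1$, and let $R\subset\mathbb{T}^2$ and the linear toral linked-twist map $H_{j,k}=G^k\circ F^j:R\to R$ be as defined in the context. If the positive integers $j$ and $k$ are each at least $2$, and one of them is at least $3$, then $R$ contains an $H_{j,k}$-invariant Cantor set $\Lambda$ such that the restriction $H_{j,k}|_\Lambda$ is topologically conjugate to the full shift on $N=(j-1)(k-1)$ symbols.
   Context: $\mathbb{S}^1=[0,1]$ with endpoints identified and $\mathbb{T}^2=\mathbb{S}^1\times\mathbb{S}^1$ with coordinates $(x,y)$. Put $P=\{(x,y):x\in\mathbb{S}^1,\ y_0\le y\le y_1\}$, $Q=\{(x,y):x_0\le x\le x_1,\ y\in\mathbb{S}^1\}$, $R=P\cup Q$. Let $f:\mathbb{S}^1\to\mathbb{S}^1$ be $f(y)=(y-y_0)/(y_1-y_0)$ for $y\in[y_0,y_1]$ and $f(y)=0$ otherwise; let $g:\mathbb{S}^1\to\mathbb{S}^1$ be $g(x)=(x-x_0)/(x_1-x_0)$ for $x\in[x_0,x_1]$ and $g(x)=0$ otherwise. Define homeomorphisms of $\mathbb{T}^2$ by $F(x,y)=(x+f(y),y)$ and $G(x,y)=(x,y+g(x))$; both preserve $R$. $H_{j,k}=G^k\circ F^j$, restricted to $R$. The full shift on $N$ symbols is the map $\sigma:\Sigma^N\to\Sigma^N$, $[\sigma(s)]_i=s_{i+1}$, where $\Sigma^N=\{1,\dots,N\}^{\mathbb{Z}}$ carries the product topology. Topological conjugacy means there is a homeomorphism $\phi:\Lambda\to\Sigma^N$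 with $\phi\circ H_{j,k}|_\Lambda=\sigma\circ\phi$. *)

(* Defs.v *)
From HB Require Import structures.
From mathcomp Require Import all_boot all_order all_algebra generic_quotient.
From mathcomp Require Import all_classical all_reals topology.

Set Implicit Arguments.
Unset Strict Implicit.
Unset Printing Implicit Defensive.

Import Order.TTheory GRing.Theory Num.Theory.
Import numFieldTopology.Exports.

Local Open Scope classical_set_scope.
Local Open Scope ring_scope.
Local Open Scope quotient_scope.

Section Circle.
Variable R : realType.

Definition unit_interval : Type := set_type `[0 : R, 1]%classic.

HB.instance Definition _ := Topological.on unit_interval.

Definition endpoint (s : unit_interval) : bool := (\val s == 0) || (\val s == 1).

Let glue (s t : unit_interval) : bool := (s == t) || (endpoint s && endpoint t).

Let glue_refl : reflexive glue.
Proof. by move=> s; rewrite /glue eqxx. Qed.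

Let glue_sym : symmetric glue.
Proof. by move=> s t; rewrite /glue eq_sym andbC. Qed.

Let glue_trans : transitive glue.
Proof.
move=> t s u /predU1P[-> //|/andP[es et]] /predU1P[<-|/andP[_ eu]].
  by rewrite /glue es et orbT.
by rewrite /glue es eu orbT.
Qed.

Definition endpoint_glue := EquivRel _ glue_refl glue_sym glue_trans.

Definition circle := {eq_quot endpoint_glue}.

HB.instance Definition _ := Topological.copy circle (quotient_topology circle).
HB.instance Definition _ := Quotient.on circle.

(* The common endpoint has the two coordinates 0 and 1, and repr picks one of
   them.  Nothing below depends on which one: the intervals [a, b] used satisfy
   0 < a < b < 1, and sums are taken modulo 1. *)
Definition circle_coord (x : circle) : R := \val (repr x).

Lemma frac_unit_interval (r : R) :
  r - (Num.floor r)%:~R \in `[0 : R, 1]%classic.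
Proof.
rewrite inE /= in_itv /= subr_ge0 floor_le /=.
by rewrite lerBlDl -(intrD1 (R := R)) ltW // floorD1_gt.
Qed.

(* The class of r modulo 1. *)
Definition circle_pt (r : R) : circle :=
  \pi_circle (exist (fun s => s \in `[0 : R, 1]%classic) _ (frac_unit_interval r)).

Definition circle_add (x y : circle) : circle := circle_pt (circle_coord x + circle_coord y).

Definition torus : Type := (circle * circle)%type.

HB.instance Definition _ := Topological.on torus.

(* Both profiles f (with [a, b] = [y0, y1]) and g (with [a, b] = [x0, x1]). *)
Definition ramp (a b : R) (t : circle) : circle :=
  if a <= circle_coord t <= b then circle_pt ((circle_coord t - a) / (b - a))
  else circle_pt 0.

Definition horizontal_annulus (y0 y1 : R) : set torus :=
  [set p | y0 <= circle_coord p.2 <= y1].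

Definition vertical_annulus (x0 x1 : R) : set torus :=
  [set p | x0 <= circle_coord p.1 <= x1].

Definition linked_annuli (x0 x1 y0 y1 : R) : set torus :=
  horizontal_annulus y0 y1 `|` vertical_annulus x0 x1.

Definition horizontal_twist (y0 y1 : R) (p : torus) : torus :=
  (circle_add p.1 (ramp y0 y1 p.2), p.2).

Definition vertical_twist (x0 x1 : R) (p : torus) : torus :=
  (p.1, circle_add p.2 (ramp x0 x1 p.1)).

Definition linked_twist (x0 x1 y0 y1 : R) (j k : nat) : torus -> torus :=
  iter k (vertical_twist x0 x1) \o iter j (horizontal_twist y0 y1).

End Circle.

Definition cantor_set (X : topologicalType) (A : set X) : Prop :=
  [/\ A !=set0, compact A, perfect_set A & totally_disconnected A].

(* The symbols 1, ..., N are represented by the elements 0, ..., N - 1 of 'I_N. *)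
Definition full_shift_space (N : nat) : Type :=
  prod_topology (fun _ : int => discrete_topology 'I_N).

HB.instance Definition _ (N : nat) := Topological.on (full_shift_space N).

Definition full_shift (N : nat) (s : full_shift_space N) : full_shift_space N :=
  fun i => s (i + 1).

Definition homeomorphism (X Y : topologicalType) (phi : X -> Y) : Prop :=
  continuous phi /\
  exists psi : Y -> X, [/\ cancel phi psi, cancel psi phi & continuous psi].

Definition topologically_conjugate (X Y : topologicalType)
    (f : X -> X) (g : Y -> Y) : Prop :=
  exists phi : X -> Y, homeomorphism phi /\ phi \o f = g \o phi.

Definition is_restriction (X : Type) (f : X -> X) (A : set X)
    (h : set_type A -> set_type A) : Prop :=
  forall x, \val (h x) = f (\val x).

(* Main.v *)
Require Import Defs.
From mathcomp Require Import all_boot all_order all_algebra generic_quotient.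
From mathcomp Require Import all_classical all_reals topology normedtype.
From mathcomp Require Import sequences.
From mathcomp Require Import ring lra.

(** The horseshoe lives in the square [x0, x1] x [y0, y1].  Put w = x1 - x0 and
    h = y1 - y0, both strictly less than 1, and write a point of the square as
    (x0 + w u, y0 + h v) with u, v in [0, 1].  While an orbit stays in the
    square, the horizontal twists displace x by j v, and the vertical ones
    displace y by k u, modulo 1.  So an orbit (u_i, v_i) that returns to the
    square at every step comes with integers m_i and n_i, its numbers of turns
    around the two circles, such that

      j v_i = m_i + w (u_(i+1) - u_i),
      k u_(i+1) = n_i + h (v_(i+1) - v_i).

    Solved for the left-hand sides and read with m and n prescribed, these
    equations say that (u, v) is a fixed point of an affine operator on bounded
    bi-infinite sequences.  As j, k >= 2, the operator contracts the sup norm by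
    the factor max(w, h) < 1; and it preserves sequences with values in [0, 1]
    exactly because 1 <= m_i <= j - 1 and 1 <= n_i <= k - 1.  Hence each of the
    bi-infinite sequences of (j - 1)(k - 1) symbols (m_i, n_i) is realised by
    exactly one orbit (solution_fixed, solution_unique), and this orbit depends
    continuously on the symbols (solution_continuous).

    The coding map sends a symbol sequence to the point of its orbit at time 0.
    It intertwines the shift with the linked twist by uniqueness
    (coding_equivariant).  It is injective because w, h < 1: a point of the
    square determines its integers, hence its next and previous points, and
    inductively the whole sequence (coding_inj).  The full shift space is
    compact and the torus is Hausdorff, so the coding map is a homeomorphism onto
    its image Lambda.  The Cantor property of Lambda is then that of the full
    shift space, which has at least two symbols since j or k is at least 3. *)

Import Order.TTheory GRing.Theory Num.Theory.
Import numFieldNormedType.Exports.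

Local Open Scope classical_set_scope.
Local Open Scope ring_scope.
Local Open Scope quotient_scope.

(** * Injective continuous images of compact spaces *)

Section CompactEmbedding.
Context {X Y : topologicalType} (f : X -> Y).
Hypotheses (cptX : compact [set: X]) (hausY : hausdorff_space Y).
Hypotheses (f_inj : injective f) (f_cont : continuous f).

Lemma closed_image_of_compact (C : set X) : closed C -> closed (f @` C).
Proof.
move=> Ccl; apply: compact_closed => //; apply: continuous_compact.
  exact: continuous_subspaceT.
by apply: subclosed_compact cptX _.
Qed.

Lemma compact_range : compact (range f).
Proof. by apply: continuous_compact => //; exact: continuous_subspaceT. Qed.

Lemma perfect_range : perfect_set [set: X] -> perfect_set (range f).
Proof.
move=> [_ limX]; have cl := closed_image_of_compact _ closedT.
split=> //; apply/seteqP; split=> [y ylim|_ [a _ <-] V Va].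
  apply: cl => V /ylim[z [_ fz Vz]]; by exists z.
have : limit_point [set: X] a by rewrite limX.
move=> /(_ _ (f_cont _ _ Va))[b [ba _ Vb]]; exists (f b); split=> //.
by rewrite (inj_eq f_inj).
Qed.

(** A clopen set separating two points of X has an image that is closed and whose
    complement in the range is closed too, so it cuts every connected subset of
    the range that contains both image points. *)
Lemma totally_disconnected_range :
  zero_dimensional X -> totally_disconnected (range f).
Proof.
move=> zX _ [a _ <-]; apply/seteqP; split=> [y|_ ->]; last first.
  by apply: connected_component_refl; exists a.
move=> [C [Ca Crange Ccon] Cy]; have [b _ fb] := Crange _ Cy.
rewrite -fb /=; congr f; apply: contrapT => /nesym/eqP ab.
have [U [[Uop Ucl] Ua Ub]] := zX _ _ ab.
have imC : C `&` f @` U = C `&` ~` (f @` ~` U).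
  apply/seteqP; split=> z [Cz fz]; split=> //.
    by case: fz => c Uc <- [d Ud /f_inj dc]; apply: Ud; rewrite dc.
  have [c _ fc] := Crange _ Cz; exists c => //.
  by apply: contrapT => Uc; apply: fz; exists c.
have : C `&` f @` U = C.
  apply: Ccon; first by exists (f a); split=> //; exists a.
    exists (~` (f @` ~` U)) => //; apply: closed_openC.
    by apply: closed_image_of_compact; exact: open_closedC.
  by exists (f @` U) => //; exact: closed_image_of_compact.
move=> /seteqP[_ /(_ _ Cy)[_ [c Uc]]]; rewrite -fb => /f_inj cb.
by apply: Ub; rewrite -cb.
Qed.

Definition to_range (a : X) : set_type (range f) := SigSub (mem_set (imageT f a)).

(** The inverse is continuous since its preimages of closed sets are images by f,
    which are closed by compactness. *)
Lemma to_range_homeomorphism :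
  exists2 g : set_type (range f) -> X, homeomorphism g &
    cancel to_range g /\ cancel g to_range.
Proof.
have rgP (y : set_type (range f)) : exists a, f a = \val y.
  by have [a _ fa] := set_mem (valP y); exists a.
have [g gE] := choice rgP.
have toK : cancel to_range g by move=> a; apply: f_inj; rewrite gE.
have gK : cancel g to_range by move=> y; apply: val_inj; rewrite /= gE.
exists g => //; split; last first.
  by exists to_range; split=> //; exact: continuous_comp_initial.
apply/continuous_closedP => C Ccl.
rewrite (_ : _ @^-1` _ = set_val @^-1` (f @` C)).
  have /continuous_closedP := @initial_continuous (set_type (range f)) Y set_val.
  by apply; exact: closed_image_of_compact.
apply/seteqP; split=> y /=.
  by move=> Cy; exists (g y); rewrite ?gE.
by move=> [c Cc cy]; rewrite (_ : g y = c) //; apply: f_inj; rewrite gE.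
Qed.

End CompactEmbedding.

Lemma hausdorff_of_injection (X Y : topologicalType) (f : X -> Y) :
  injective f -> continuous f -> hausdorff_space Y -> hausdorff_space X.
Proof.
move=> finj fc hY a b ab; apply: finj; apply: hY => U V Ua Vb.
by have [c [Uc Vc]] := ab _ _ (fc _ _ Ua) (fc _ _ Vb); exists (f c).
Qed.

Lemma hausdorff_pair (X Y : topologicalType) :
  hausdorff_space X -> hausdorff_space Y -> hausdorff_space (X * Y)%type.
Proof.
move=> hX hY [a b] [c d] cl; congr pair.
- apply: hX => U V Ua Vc.
  have [|[e e'] []/=] := cl (fst @^-1` U) (fst @^-1` V) (cvg_fst Ua).
    exact: (cvg_fst Vc).
  by exists e.
- apply: hY => U V Ua Vc.
  have [|[e e'] []/=] := cl (snd @^-1` U) (snd @^-1` V) (cvg_snd Ua).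
    exact: (cvg_snd Vc).
  by exists e'.
Qed.

(** * The full shift space *)

Section FullShiftSpace.
Variable N : nat.
Local Notation Sigma := (full_shift_space N).

Lemma symbol_continuous (i : int) :
  continuous (fun s : Sigma => s i : discrete_topology 'I_N).
Proof. exact: (@proj_continuous int (fun=> discrete_topology 'I_N)). Qed.

Lemma full_shift_space_compact : compact [set: Sigma].
Proof.
have := @tychonoff int (fun=> discrete_topology 'I_N) (fun=> setT).
rewrite (_ : [set s | _] = [set: Sigma]); first apply; last by apply/seteqP; split.
by move=> _; apply: finite_compact; exact: finite_finset.
Qed.

Lemma full_shift_space_zero_dimensional : zero_dimensional Sigma.
Proof.
apply: (@zero_dimension_prod int (fun=> discrete_topology 'I_N)) => _.
exact: discrete_zero_dimension.
Qed.

(** Changing a sequence s at the single coordinate n gives a sequence different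
    from s that tends to s as n grows, so no point is isolated. *)
Lemma full_shift_space_perfect : (1 < N)%N -> perfect_set [set: Sigma].
Proof.
move=> N1; apply/perfectTP => s sop.
pose other (a : 'I_N) : 'I_N :=
  if val a == 0%N then Ordinal N1 else Ordinal (ltnW N1).
have otherE a : other a <> a.
  rewrite /other; case: eqP => a0 /(congr1 val)/=; last by move/esym.
  by rewrite a0.
pose t (n : nat) : Sigma := fun i => if i == n%:Z then other (s i) else s i.
have ts : t @ \oo --> s.
  apply/cvg_sup => i U [V] [[W] oW <-] WfN WU.
  apply: (filterS WU); rewrite nbhs_simpl /=.
  (* The coordinate i is no longer altered once n > |i|. *)
  exists `|i|%N.+1 => // n /= ltin; rewrite /t.
  by case: eqP => // iN; move: ltin; rewrite iN /= ltnn.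
have /ts[n _ /(_ n (leqnn n)) /= tn] : nbhs s [set s] by apply: open_nbhs_nbhs.
by apply: (otherE (s n%:Z)); rewrite -{2}tn /t eqxx.
Qed.

Lemma full_shift_surjective (s : Sigma) : exists t, full_shift t = s.
Proof. by exists (fun i => s (i - 1)); apply/funext => i; rewrite /full_shift addrK. Qed.

End FullShiftSpace.

(** * The circle and the twists *)

Section CircleArithmetic.
Context {R : realType}.
Implicit Types (a b x y : R) (s t : unit_interval R).

Lemma circle_pi_eq s t :
  \pi_(circle R) s = \pi_(circle R) t <-> (s == t) || endpoint s && endpoint t.
Proof.
split=> [st|st]; first by rewrite -[_ || _]/(endpoint_glue R s t) -eqmodE st.
by apply/eqmodP.
Qed.

Lemma circle_pt_pi a s : 0 < a < 1 -> \val s = a -> circle_pt a = \pi_(circle R) s.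
Proof.
move=> /andP[a0 a1] sa.
have fl0 : Num.floor a = 0 by apply: floor_def; rewrite ltW.
by congr (\pi_(circle R) _); apply: val_inj; rewrite /= sa fl0 subr0.
Qed.

Lemma circle_pt_int a (z : int) : circle_pt (a + z%:~R) = circle_pt a.
Proof.
congr (\pi_(circle R) _); apply: val_inj => /=.
by rewrite floorDrz ?intr_int // intrKfloor intrD opprD addrACA subrr addr0.
Qed.

(** A representative can differ from the chosen one only at the glued endpoints,
    where both coordinates are integers. *)
Lemma circle_coord_pi s :
  circle_coord (\pi_(circle R) s) = \val s \/
  endpoint s /\ endpoint (repr (\pi_(circle R) s)).
Proof.
rewrite /circle_coord.
have /circle_pi_eq/predU1P[->|/andP[]] := reprK (\pi_(circle R) s); first by left.
by right.
Qed.

Lemma circle_coord_pt a : exists z : int, circle_coord (circle_pt a) = a + z%:~R.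
Proof.
pose s : unit_interval R := SigSub (frac_unit_interval a).
have [->|[]] := circle_coord_pi s.
  by exists (- Num.floor a); rewrite /= intrN.
rewrite /endpoint -/(circle_coord (circle_pt a)) => se te.
have [n ne] : exists n : int, \val s = n%:~R.
  by case/orP: se => /eqP ->; [exists 0|exists 1].
have [m ->] : exists n : int, circle_coord (circle_pt a) = n%:~R.
  by case/orP: te => /eqP ->; [exists 0|exists 1].
exists (m - n - Num.floor a); move: ne => /=; rewrite !intrB; lra.
Qed.

Lemma circle_coord_ptK a : 0 < a < 1 -> circle_coord (circle_pt a) = a.
Proof.
move=> /andP[a0 a1]; have aI : a \in `[0 : R, 1]%classic.
  by rewrite inE /= in_itv /= !ltW.
pose s : unit_interval R := SigSub aI.
rewrite (@circle_pt_pi a s) ?a0 ?a1 //.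
have [//|[]] := circle_coord_pi s.
by rewrite /endpoint /= (gt_eqF a0) (lt_eqF a1).
Qed.

Lemma circle_ptD a b : circle_add (circle_pt a) (circle_pt b) = circle_pt (a + b).
Proof.
rewrite /circle_add.
have [m ->] := circle_coord_pt a; have [n ->] := circle_coord_pt b.
by rewrite addrACA -intrD circle_pt_int.
Qed.

(** A parametrised closed curve in the plane whose only double point is the common
    image of 0 and 1: the first component determines t up to the symmetry
    t -> 1 - t, and the second one is odd under that symmetry, so it separates
    the two candidates except at 0, 1 / 2 and 1. *)
Definition plane_loop (t : R) : R * R := (t * (1 - t), t * (1 - t) * (2 * t - 1)).

Lemma plane_loop_continuous : continuous plane_loop.
Proof.
have c1 : continuous (fun t : R => t * (1 - t)).
  by move=> t; apply: cvgM; [exact: cvg_id|apply: cvgB; [exact: cvg_cst|exact: cvg_id]].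
have c2 : continuous (fun t : R => t * (1 - t) * (2 * t - 1)).
  move=> t; apply: cvgM; first exact: c1.
  apply: cvgB; last exact: cvg_cst.
  by apply: cvgM; [exact: cvg_cst|exact: cvg_id].
move=> t; exact: (cvg_pair (c1 t) (c2 t)).
Qed.

Lemma plane_loop_endpoint s : endpoint s -> plane_loop (\val s) = (0, 0).
Proof. by rewrite /endpoint /plane_loop => /orP[/eqP->|/eqP->]; congr pair; ring. Qed.

Lemma plane_loop_eq s t : plane_loop (\val s) = plane_loop (\val t) ->
  (s == t) || endpoint s && endpoint t.
Proof.
rewrite /endpoint -val_eqE /plane_loop; move: (\val s) (\val t) => x y [xy1 xy2].
have : (x - y) * (1 - x - y) = x * (1 - x) - y * (1 - y) by ring.
rewrite xy1 subrr => /eqP; rewrite mulf_eq0 => /orP[|/eqP yx].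
  by rewrite subr_eq0 => ->.
have {}yx : y = 1 - x by lra.
have : x * ((1 - x) * (2 * x - 1)) = 0 by move: xy2; rewrite yx; lra.
rewrite yx => /eqP; rewrite !mulf_eq0 => /or3P[/eqP->|x1|/eqP x2].
- by rewrite subr0 !eqxx !orbT.
- by rewrite (eq_sym x 1) -(subr_eq0 1 x) x1 !orbT.
- by apply/orP; left; apply/eqP; lra.
Qed.

(** The planar loop factors through an injective continuous map on the circle. *)
Lemma circle_hausdorff : hausdorff_space (circle R).
Proof.
pose f : circle R -> R * R := (plane_loop \o \val) \o repr.
apply: (@hausdorff_of_injection _ _ f); last 1 first.
- by apply: hausdorff_pair; exact: Rhausdorff.
- move=> a b fab; rewrite -[a]reprK -[b]reprK; apply/circle_pi_eq.
  exact: plane_loop_eq.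
- apply: (@repr_comp_continuous (unit_interval R) _ (R * R)%type (plane_loop \o \val)).
    move=> s; apply: continuous_comp; last exact: plane_loop_continuous.
    exact: initial_continuous.
  move=> s t /eqP/circle_pi_eq/predU1P[-> //|/andP[se te]].
  by rewrite /= !plane_loop_endpoint.
Qed.

Lemma torus_hausdorff : hausdorff_space (torus R).
Proof. by apply: hausdorff_pair; exact: circle_hausdorff. Qed.

(** Away from the integers reduction modulo 1 does not jump, and circle_pt is the
    continuous quotient map. *)
Lemma circle_pt_continuous (X : topologicalType) (f : X -> R) :
  continuous f -> (forall p, 0 < f p < 1) -> continuous ((@circle_pt R) \o f).
Proof.
move=> fc f01.
have fI p : f p \in `[0 : R, 1]%classic.
  by rewrite inE /= in_itv /=; have /andP[? ?] := f01 p; rewrite !ltW.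
pose g p : unit_interval R := SigSub (fI p).
have -> : (@circle_pt R) \o f = \pi_(circle R) \o g.
  by apply/funext => x /=; exact: circle_pt_pi.
have gc : continuous g by apply: continuous_comp_initial; exact: fc.
move=> x; apply: continuous_comp; first exact: gc.
exact: (@pi_continuous (unit_interval R)).
Qed.

Section Twists.
Variables (a b : R).
Hypotheses (a0 : 0 < a) (ab : a < b) (b1 : b < 1).

Lemma ramp_pt y : a <= y <= b -> ramp a b (circle_pt y) = circle_pt ((y - a) / (b - a)).
Proof.
move=> /andP[ay yb]; have y01 : 0 < y < 1 by rewrite (lt_le_trans a0) ?(le_lt_trans yb).
by rewrite /ramp circle_coord_ptK // ay yb.
Qed.

Lemma iter_horizontal_twist n x y : a <= y <= b ->
  iter n (horizontal_twist a b) (circle_pt x, circle_pt y) =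
  (circle_pt (x + n%:R * ((y - a) / (b - a))), circle_pt y).
Proof.
move=> yab; elim: n => [|n IH]; first by rewrite mul0r addr0.
rewrite iterS IH /horizontal_twist /= ramp_pt // circle_ptD.
by congr (circle_pt _, _); rewrite -natr1; ring.
Qed.

Lemma iter_vertical_twist n x y : a <= x <= b ->
  iter n (vertical_twist a b) (circle_pt x, circle_pt y) =
  (circle_pt x, circle_pt (y + n%:R * ((x - a) / (b - a)))).
Proof.
move=> xab; elim: n => [|n IH]; first by rewrite mul0r addr0.
rewrite iterS IH /vertical_twist /= ramp_pt // circle_ptD.
by congr (_, circle_pt _); rewrite -natr1; ring.
Qed.

End Twists.
End CircleArithmetic.

(** * Contracting couplings of real sequences *)

Section GeometricRate.
Context {R : realType} (l : R).
Hypotheses (l0 : 0 <= l) (l1 : l < 1).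

Lemma exists_expr_lt (e : R) : 0 < e -> exists n, l ^+ n < e.
Proof.
move=> e0; have ln1 : `|l| < 1 by rewrite ger0_norm.
have [n _ /(_ n (leqnn n))/=] := cvgr_dist_lt _ _ (cvg_expr ln1) _ e0.
by rewrite sub0r normrN ger0_norm ?exprn_ge0 //; exists n.
Qed.

Lemma expr_bound_eq (x y C : R) : (forall n, `|x - y| <= C * l ^+ n) -> x = y.
Proof.
move=> xyC; apply/eqP; rewrite -subr_eq0 -normr_le0; apply/ler_addgt0Pl => e e0.
rewrite addr0; have C0 : 0 < `|C| + 1 by rewrite ltr_wpDl.
have [n ln] := exists_expr_lt _ (divr_gt0 e0 C0).
rewrite ltr_pdivlMr // in ln.
apply: (le_trans (xyC n)); have := exprn_ge0 n l0; have := ler_norm C; nra.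
Qed.

End GeometricRate.

(** A system z i = c i + b i * (z (nxt i) - z (prv i)) of equations for a family
    of reals over an arbitrary index type: only the inequality 2 * b i <= l < 1
    matters for the contraction, not the shape of the index type. *)
Section CoupledSystem.
Context {R : realType} {I : Type} (nxt prv : I -> I) (b : I -> R) (l : R).
Hypotheses (l1 : l < 1) (b_ge0 : forall i, 0 <= b i) (b_le : forall i, 2 * b i <= l).
Implicit Types (c z : I -> R).

Definition unit_valued z := forall i, 0 <= z i <= 1.

Definition coupling c z i := c i + b i * (z (nxt i) - z (prv i)).

(** The condition under which the right-hand side of the system stays in [0, 1]
    whenever the unknowns are in [0, 1]. *)
Definition admissible c := forall i, b i <= c i <= 1 - b i.

Lemma coupling_unit c z : admissible c -> unit_valued z -> unit_valued (coupling c z).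
Proof.
move=> cadm z01 i; rewrite /coupling.
have := z01 (nxt i); have := z01 (prv i); have := cadm i; have := b_ge0 i.
by move=> bi /andP[c0 c1] /andP[p0 p1] /andP[n0 n1]; apply/andP; split; nra.
Qed.

Lemma coupling_contraction c z z' e : (forall i, `|z i - z' i| <= e) ->
  forall i, `|coupling c z i - coupling c z' i| <= l * e.
Proof.
move=> zz i; rewrite /coupling.
have -> : c i + b i * (z (nxt i) - z (prv i)) - (c i + b i * (z' (nxt i) - z' (prv i)))
  = b i * ((z (nxt i) - z' (nxt i)) - (z (prv i) - z' (prv i))) by ring.
rewrite normrM ger0_norm //.
have e0 : 0 <= e by apply: le_trans (zz i).
have : `|z (nxt i) - z' (nxt i) - (z (prv i) - z' (prv i))| <= 2 * e.
  apply: (le_trans (ler_normB _ _)).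
  by have := zz (nxt i); have := zz (prv i); lra.
have := b_ge0 i; have := b_le i; nra.
Qed.

Lemma factor_ge0 (i : I) : 0 <= l.
Proof. by have := b_ge0 i; have := b_le i; lra. Qed.

Lemma iter_coupling_dist c z z' n : admissible c -> unit_valued z -> unit_valued z' ->
  forall i, `|iter n (coupling c) z i - iter n (coupling c) z' i| <= l ^+ n.
Proof.
move=> cadm z0 z0'; elim: n => [|n IH] i.
  rewrite expr0 /= ler_norml; have /andP[? ?] := z0 i; have /andP[? ?] := z0' i.
  by apply/andP; split; lra.
by rewrite exprS; apply: coupling_contraction.
Qed.

Definition approx c n := iter n (coupling c) (fun=> 0).

Lemma approx_unit c n : admissible c -> unit_valued (approx c n).
Proof.
move=> cadm; elim: n => [|n IH] /=; last exact: coupling_unit.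
by move=> i; rewrite lexx ler01.
Qed.

(** A later iterate is the n-th iterate started at another family with values in
    [0, 1], so no summation of a geometric series is needed. *)
Lemma approx_dist c m n i : admissible c -> 
  `|approx c (n + m) i - approx c n i| <= l ^+ n.
Proof.
move=> cadm; rewrite /approx iterD; apply: iter_coupling_dist => //.
- exact: approx_unit.
- by move=> ?; rewrite lexx ler01.
Qed.

(** The limit of the iterates, written as a supremum: the numbers
    approx c n i - l ^+ n are lower bounds of the limit, and the numbers
    approx c n i + l ^+ n are upper bounds of it. *)
Definition solution c i := sup [set approx c n i - l ^+ n | n in [set: nat]].

Lemma solution_approx c n i : admissible c -> `|solution c i - approx c n i| <= l ^+ n.
Proof.
move=> cadm; have l0 := factor_ge0 i.
(* Every lower estimate is below every upper one, so the supremum is between. *)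
have bound m k : approx c m i - l ^+ m <= approx c k i + l ^+ k.
  have := exprn_ge0 m l0; have := exprn_ge0 k l0.
  have [/subnKC <-|/ltnW/subnKC <-] := leqP m k.
    have := approx_dist c (k - m) m i cadm; rewrite ler_norml => /andP[].
    lra.
  have := approx_dist c (m - k) k i cadm; rewrite ler_norml => /andP[].
  lra.
have ub k : ubound [set approx c n i - l ^+ n | n in [set: nat]] (approx c k i + l ^+ k).
  by move=> _ [m _ <-].
have le1 : approx c n i - l ^+ n <= solution c i.
  by apply: ub_le_sup; [exists (approx c n i + l ^+ n); exact: ub|exists n].
have le2 : solution c i <= approx c n i + l ^+ n.
  by apply: ge_sup; [exists (approx c n i - l ^+ n), n|exact: ub].
by rewrite ler_norml; apply/andP; split; lra.
Qed.

Lemma solution_unit c : admissible c -> unit_valued (solution c).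
Proof.
move=> cadm i; have l0 := factor_ge0 i.
have P n : - l ^+ n <= solution c i <= 1 + l ^+ n.
  have := solution_approx c n i cadm; have := approx_unit c n cadm i.
  by rewrite ler_norml => /andP[? ?] /andP[? ?]; apply/andP; split; lra.
apply/andP; split; apply/ler_addgt0Pl => e e0;
  have [n ln] := exists_expr_lt l l0 l1 e e0; have /andP[] := P n; lra.
Qed.

Lemma solution_fixed c i : admissible c -> solution c i = coupling c (solution c) i.
Proof.
move=> cadm; have l0 := factor_ge0 i; apply: (expr_bound_eq l l0 l1 _ _ (2 * l)) => n.
have := coupling_contraction c _ _ _ (fun i => solution_approx c n i cadm) i.
have := solution_approx c n.+1 i cadm.
rewrite distrC -[approx c n.+1 i]/(coupling c (approx c n) i) exprS => h1 h2.
rewrite -(subrKA (coupling c (approx c n) i)) (le_trans (ler_normD _ _)) //.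
by move: h1 h2; rewrite distrC [X in _ -> X <= _ -> _]distrC; lra.
Qed.

(** A fixed point is its own n-th iterate, and n-th iterates of families with
    values in [0, 1] are within l ^+ n of each other. *)
Lemma solution_unique c z : admissible c -> unit_valued z ->
  (forall i, z i = coupling c z i) -> forall i, z i = solution c i.
Proof.
move=> cadm z01 zfix i; apply: (expr_bound_eq l (factor_ge0 i) l1 _ _ 1) => n.
have it w : (forall i, w i = coupling c w i) -> iter n (coupling c) w = w.
  by move=> /funext wE; elim: n => //= n ->.
rewrite mul1r -{1}(it z zfix) -{1}(it (solution c)) => [|i']; last exact: solution_fixed.
by apply: iter_coupling_dist => //; exact: solution_unit.
Qed.

(** The solution is the uniform limit of its iterates, which are obtained from c
    by finitely many additions and multiplications. *)
Lemma solution_continuous (X : topologicalType) (c : X -> I -> R) :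
  (forall s, admissible (c s)) -> (forall i, continuous (c^~ i)) ->
  forall i, continuous (fun s => solution (c s) i).
Proof.
move=> cadm cc.
have ac n i : continuous (fun s => approx (c s) n i).
  elim: n i => [|n IH] i s /=; first exact: cvg_cst.
  apply: cvgD; first exact: cc.
  by apply: cvgM; [exact: cvg_cst|apply: cvgB; exact: IH].
move=> i s; apply/cvgrPdist_lt => e e0.
have [n ln] := exists_expr_lt l (factor_ge0 i) l1 (e / 3) ltac:(lra).
have := cvgr_dist_lt _ _ (ac n i s) (e / 3) ltac:(lra).
apply: filterS => t.
have := solution_approx _ n i (cadm s); have := solution_approx _ n i (cadm t).
rewrite ler_norml !ltr_norml ler_norml => /andP[? ?] /andP[? ?] /andP[? ?].
by apply/andP; split; lra.
Qed.

End CoupledSystem.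

(** * Orbits with prescribed turns *)

Lemma int_bidirectional_ind (P : int -> Prop) : P 0 ->
  (forall i, P i -> P (i + 1)) -> (forall i, P (i + 1) -> P i) -> forall i, P i.
Proof.
move=> P0 Pup Pdown; elim/int_ind => // n Pn; first by rewrite -addn1 PoszD; apply: Pup.
by apply: Pdown; rewrite -addn1 PoszD opprD subrK.
Qed.

(** The arithmetic behind the injectivity of the coding: since the sides of the
    square are shorter than the circle, the position reached by a twist fixes
    the number of turns. *)
Lemma natr_sub_small (R : realType) (m n : nat) (w d : R) :
  0 < w < 1 -> `|d| <= 1 -> m%:R - n%:R = w * d -> m = n /\ d = 0.
Proof.
move=> /andP[w0 w1] d1 mn.
have wd1 : `|w * d| < 1 by rewrite normrM gtr0_norm //; nra.
have mnE : m = n.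
  apply/eqP; rewrite -eqz_nat -subr_eq0 -normr_le0 -ltzD1 add0r.
  by rewrite -(ltr_int R) intr_norm rmorphB /= mn.
split=> //; apply: (mulfI (lt0r_neq0 w0)); rewrite -mn mnE subrr mulr0 //.
Qed.

Section Coding.
Context {R : realType} (x0 x1 y0 y1 : R) (j k : nat).
Hypotheses (x0_gt0 : 0 < x0) (x01 : x0 < x1) (x1_lt1 : x1 < 1).
Hypotheses (y0_gt0 : 0 < y0) (y01 : y0 < y1) (y1_lt1 : y1 < 1).
Hypotheses (j2 : (2 <= j)%N) (k2 : (2 <= k)%N).

Local Notation N := ((j - 1) * (k - 1))%N.
Local Notation Sigma := (full_shift_space N).
Local Notation w := (x1 - x0).
Local Notation h := (y1 - y0).

Implicit Types (s t : Sigma) (a : 'I_N) (p : int * bool).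

(** A symbol encodes a pair of numbers of turns, (m, n) with 1 <= m <= j - 1 and
    1 <= n <= k - 1, by division with remainder by k - 1. *)
Definition x_winding a : nat := (a %/ (k - 1)).+1.
Definition y_winding a : nat := (a %% (k - 1)).+1.

Lemma winding_inj a a' :
  x_winding a = x_winding a' -> y_winding a = y_winding a' -> a = a'.
Proof.
move=> [xa] [ya]; apply: val_inj => /=.
by rewrite (divn_eq a (k - 1)) xa ya -divn_eq.
Qed.

Lemma x_winding_bounds a : 1 <= ((x_winding a)%:R : R) <= j%:R - 1.
Proof.
rewrite -(natrB _ (ltnW j2)) ler1n ler_nat /x_winding /=.
by rewrite ltn_divLR ?subn_gt0 // ltn_ord.
Qed.

Lemma y_winding_bounds a : 1 <= ((y_winding a)%:R : R) <= k%:R - 1.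
Proof.
rewrite -(natrB _ (ltnW k2)) ler1n ler_nat /y_winding /=.
by rewrite ltn_mod subn_gt0.
Qed.

(** The unknowns u_i and v_i of the horseshoe equations form a single family
    indexed by int * bool: (i, false) stands for u_i and (i, true) for v_i.
    Each equation couples an unknown with its two neighbours in the order
    ... u_i, v_i, u_(i+1), v_(i+1) ... *)
Definition succ_site p : int * bool := if p.2 then (p.1 + 1, false) else (p.1, true).
Definition pred_site p : int * bool := if p.2 then (p.1, false) else (p.1 - 1, true).
Definition weight p : R := if p.2 then w / j%:R else h / k%:R.
(** The equation for u_i comes from the vertical twists of the step that ends at
    time i, so it involves the symbol at i - 1. *)
Definition forcing s p : R :=
  if p.2 then (x_winding (s p.1))%:R / j%:R else (y_winding (s (p.1 - 1)))%:R / k%:R.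
Definition rate : R := Num.max w h.
Definition orbit s : int * bool -> R :=
  solution succ_site pred_site weight rate (forcing s).

Let w01 : 0 < w < 1.
Proof. by move: x0_gt0 x01 x1_lt1 => *; apply/andP; split; lra. Qed.
Let h01 : 0 < h < 1.
Proof. by move: y0_gt0 y01 y1_lt1 => *; apply/andP; split; lra. Qed.
Let j_ge2 : 2 <= j%:R :> R. Proof. by rewrite ler_nat. Qed.
Let k_ge2 : 2 <= k%:R :> R. Proof. by rewrite ler_nat. Qed.
Let j_gt0 : 0 < j%:R :> R. Proof. by rewrite ltr0n ltnW. Qed.
Let k_gt0 : 0 < k%:R :> R. Proof. by rewrite ltr0n ltnW. Qed.

Lemma rate_lt1 : rate < 1.
Proof. by rewrite /rate gt_max; have /andP[_ ->] := w01; have /andP[_ ->] := h01. Qed.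

Lemma weight_ge0 p : 0 <= weight p.
Proof.
have /andP[? _] := w01; have /andP[? _] := h01.
by rewrite /weight; case: ifP => _; rewrite ltW // divr_gt0.
Qed.

Lemma weight_le p : 2 * weight p <= rate.
Proof.
rewrite /weight /rate le_max; case: ifP => _; apply/orP; [left|right];
  rewrite mulrA ler_pdivrMr //.
  by have := j_ge2; have /andP[+ _] := w01; nra.
by have := k_ge2; have /andP[+ _] := h01; nra.
Qed.

Lemma forcing_admissible s : admissible weight (forcing s).
Proof.
move=> p; rewrite /weight /forcing; case: ifP => _.
  have := x_winding_bounds (s p.1); have := w01.
  move: (x_winding _)%:R => m /andP[_ w1] /andP[m1 mj].
  rewrite ler_pM2r ?invr_gt0 // -{2}(divff (lt0r_neq0 j_gt0)) -mulrBl.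
  by rewrite ler_pM2r ?invr_gt0 //; apply/andP; split; lra.
have := y_winding_bounds (s (p.1 - 1)); have := h01.
move: (y_winding _)%:R => m /andP[_ w1] /andP[m1 mj].
rewrite ler_pM2r ?invr_gt0 // -{2}(divff (lt0r_neq0 k_gt0)) -mulrBl.
by rewrite ler_pM2r ?invr_gt0 //; apply/andP; split; lra.
Qed.

Lemma orbit_unit s p : 0 <= orbit s p <= 1.
Proof.
exact: (solution_unit _ _ _ _ rate_lt1 weight_ge0 weight_le _ (forcing_admissible s)).
Qed.

Lemma orbit_coupling s p :
  orbit s p = coupling succ_site pred_site weight (forcing s) (orbit s) p.
Proof.
exact: (solution_fixed _ _ _ _ rate_lt1 weight_ge0 weight_le _ _ (forcing_admissible s)).
Qed.

Lemma orbit_x_step s i : j%:R * orbit s (i, true) =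
  (x_winding (s i))%:R + w * (orbit s (i + 1, false) - orbit s (i, false)).
Proof.
rewrite orbit_coupling /coupling /weight /forcing /succ_site /pred_site /=.
by field; exact: lt0r_neq0.
Qed.

Lemma orbit_y_step s i : k%:R * orbit s (i + 1, false) =
  (y_winding (s i))%:R + h * (orbit s (i + 1, true) - orbit s (i, true)).
Proof.
rewrite orbit_coupling /coupling /weight /forcing /succ_site /pred_site /= addrK.
by field; exact: lt0r_neq0.
Qed.

(** Translating the orbit of s in time solves the equations of the shifted
    sequence, so uniqueness applies. *)
Lemma orbit_shift s i b : orbit (full_shift s) (i, b) = orbit s (i + 1, b).
Proof.
pose z p := orbit s (p.1 + 1, p.2).
rewrite -[RHS]/(z (i, b)); apply/esym; move: (i, b) => {i b}.
apply: (solution_unique _ _ _ _ rate_lt1 weight_ge0 weight_le).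
- exact: forcing_admissible.
- by move=> p; exact: orbit_unit.
move=> [i []]; rewrite /z orbit_coupling /coupling /weight /forcing;
  rewrite /succ_site /pred_site /full_shift /=.
  by [].
by rewrite subrK addrK.
Qed.

Lemma orbit_continuous p : continuous (fun s => orbit s p).
Proof.
apply: (solution_continuous _ _ _ _ rate_lt1 weight_ge0 weight_le _ forcing).
  exact: forcing_admissible.
have sc (F : 'I_N -> R) i : continuous (fun s : Sigma => F (s i)).
  move=> s.
  apply: (@continuous_comp _ (discrete_topology 'I_N) _ (fun s : Sigma => s i) F).
    exact: symbol_continuous.
  (* Every map out of a discrete space is continuous. *)
  by move=> U /nbhs_singleton FU; apply/principal_filterP.
move=> [i []]; rewrite /forcing /=.
  exact: (sc (fun a => (x_winding a)%:R / j%:R)).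
exact: (sc (fun a => (y_winding a)%:R / k%:R)).
Qed.

Let orbit_dist s t p : `|orbit s p - orbit t p| <= 1.
Proof.
have /andP[? ?] := orbit_unit s p; have /andP[? ?] := orbit_unit t p.
by rewrite ler_norml; apply/andP; split; lra.
Qed.

(** From equal points the horizontal twists displace x by the same amount.  The
    two next x coordinates thus differ by an integer, the difference of the
    numbers m_i, and they lie in an interval of length w < 1, so they agree.  The
    vertical twists then give n_i and the next v in the same way. *)
Lemma orbit_eq_forward s t i :
  (forall b, orbit s (i, b) = orbit t (i, b)) ->
  s i = t i /\ forall b, orbit s (i + 1, b) = orbit t (i + 1, b).
Proof.
move=> st; have := orbit_x_step s i; rewrite !st orbit_x_step => xs.
have [|mE /eqP] := @natr_sub_small R (x_winding (s i)) (x_winding (t i)) w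
  (orbit t (i + 1, false) - orbit s (i + 1, false)) w01 (orbit_dist _ _ _); first by lra.
rewrite subr_eq0 => /eqP uE.
have := orbit_y_step s i; rewrite -uE orbit_y_step !st => ys.
have [|nE /eqP] := @natr_sub_small R (y_winding (s i)) (y_winding (t i)) h
  (orbit t (i + 1, true) - orbit s (i + 1, true)) h01 (orbit_dist _ _ _); first by lra.
rewrite subr_eq0 => /eqP vE.
by split; [exact: winding_inj|case].
Qed.

(** The inverse step undoes the vertical twists first, so v comes before u. *)
Lemma orbit_eq_backward s t i :
  (forall b, orbit s (i + 1, b) = orbit t (i + 1, b)) ->
  forall b, orbit s (i, b) = orbit t (i, b).
Proof.
move=> st; have := orbit_y_step s i; rewrite !st orbit_y_step => ys.
have [|_ /eqP] := @natr_sub_small R (y_winding (s i)) (y_winding (t i)) h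
  (orbit s (i, true) - orbit t (i, true)) h01 (orbit_dist _ _ _); first by lra.
rewrite subr_eq0 => /eqP vE.
have := orbit_x_step s i; rewrite vE orbit_x_step !st => xs.
have [|_ /eqP] := @natr_sub_small R (x_winding (s i)) (x_winding (t i)) w
  (orbit s (i, false) - orbit t (i, false)) w01 (orbit_dist _ _ _); first by lra.
by rewrite subr_eq0 => /eqP uE; case.
Qed.

Lemma orbit_inj s t : (forall b, orbit s (0, b) = orbit t (0, b)) -> s = t.
Proof.
move=> st0; apply/funext => i.
suff : forall b, orbit s (i, b) = orbit t (i, b) by case/orbit_eq_forward.
elim/int_bidirectional_ind: i => // i; first by case/orbit_eq_forward.
exact: orbit_eq_backward.
Qed.

Definition x_coord s : R := x0 + w * orbit s (0, false).
Definition y_coord s : R := y0 + h * orbit s (0, true).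
Definition coding s : torus R := (circle_pt (x_coord s), circle_pt (y_coord s)).

Lemma x_coord_itv s : x0 <= x_coord s <= x1.
Proof.
have /andP[? ?] := orbit_unit s (0, false); have /andP[? ?] := w01.
by rewrite /x_coord; apply/andP; split; nra.
Qed.

Lemma y_coord_itv s : y0 <= y_coord s <= y1.
Proof.
have /andP[? ?] := orbit_unit s (0, true); have /andP[? ?] := h01.
by rewrite /y_coord; apply/andP; split; nra.
Qed.

Let x_coord01 s : 0 < x_coord s < 1.
Proof. by move: x0_gt0 x1_lt1 (x_coord_itv s) => ? ? /andP[? ?];
  apply/andP; split; lra. Qed.

Let y_coord01 s : 0 < y_coord s < 1.
Proof. by move: y0_gt0 y1_lt1 (y_coord_itv s) => ? ? /andP[? ?];
  apply/andP; split; lra. Qed.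

Lemma coding_in_annuli s : linked_annuli x0 x1 y0 y1 (coding s).
Proof. by left; rewrite /horizontal_annulus /= circle_coord_ptK // y_coord_itv. Qed.

Lemma coding_inj : injective coding.
Proof.
move=> s t [/(congr1 (@circle_coord R)) + /(congr1 (@circle_coord R))].
rewrite !circle_coord_ptK // => /addrI xE /addrI yE.
have /andP[/lt0r_neq0 wn _] := w01; have /andP[/lt0r_neq0 hn _] := h01.
by apply: orbit_inj => -[]; [exact: (mulfI hn)|exact: (mulfI wn)].
Qed.

Lemma coding_continuous : continuous coding.
Proof.
have xc : continuous x_coord.
  by move=> s; exact: (cvgD (cvg_cst x0) (cvgM (cvg_cst w) (orbit_continuous _ s))).
have yc : continuous y_coord.
  by move=> s; exact: (cvgD (cvg_cst y0) (cvgM (cvg_cst h) (orbit_continuous _ s))).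
move=> s; apply: (cvg_pair (circle_pt_continuous _ _ xc x_coord01 s)
  (circle_pt_continuous _ _ yc y_coord01 s)).
Qed.

(** The orbit equations say that j v_0 and k u_1 are the displacements from the
    point at time 0 to the one at time 1, up to the integers m_0 and n_0. *)
Lemma coding_equivariant s :
  linked_twist x0 x1 y0 y1 j k (coding s) = coding (full_shift s).
Proof.
have /andP[/lt0r_neq0 wn _] := w01; have /andP[/lt0r_neq0 hn _] := h01.
rewrite /linked_twist /coding /=.
rewrite iter_horizontal_twist ?y_coord_itv //.
have -> : circle_pt (x_coord s + j%:R * ((y_coord s - y0) / h)) =
    circle_pt (x_coord (full_shift s)).
  rewrite -(circle_pt_int (x_coord (full_shift s)) (x_winding (s 0))).
  congr circle_pt; rewrite /x_coord /y_coord orbit_shift.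
  rewrite [y0 + _]addrC addrK mulrAC divff // mul1r.
  by rewrite orbit_x_step; ring.
rewrite iter_vertical_twist ?x_coord_itv //; congr pair.
rewrite -(circle_pt_int (y_coord (full_shift s)) (y_winding (s 0))).
congr circle_pt; rewrite /x_coord /y_coord !orbit_shift.
rewrite [x0 + _]addrC addrK mulrAC divff // mul1r.
by rewrite orbit_y_step; ring.
Qed.

End Coding.

Theorem theorem1p3p1 (R : realType) (x0 x1 y0 y1 : R) (j k : nat) :
  0 < x0 -> x0 < x1 -> x1 < 1 ->
  0 < y0 -> y0 < y1 -> y1 < 1 ->
  (2 <= j)%N -> (2 <= k)%N -> (3 <= j)%N \/ (3 <= k)%N ->
  exists Lambda : set (torus R),
    [/\ Lambda `<=` linked_annuli x0 x1 y0 y1,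
        linked_twist x0 x1 y0 y1 j k @` Lambda = Lambda,
        cantor_set Lambda &
        exists h : set_type Lambda -> set_type Lambda,
          is_restriction (linked_twist x0 x1 y0 y1 j k) h /\
          topologically_conjugate h (@full_shift ((j - 1) * (k - 1))%N)].
Proof.
move=> x00 x01 x11 y00 y01 y11 j2 k2 jk3.
have N1 : (1 < (j - 1) * (k - 1))%N.
  by case: jk3 => ?; [apply: (@leq_mul 2 1)|apply: (@leq_mul 1 2)]; rewrite ltn_subRL.
set N := ((j - 1) * (k - 1))%N in N1 *.
pose c : full_shift_space N -> torus R := coding x0 x1 y0 y1 j k.
have cI : injective c by exact: coding_inj.
have cC : continuous c by exact: coding_continuous.
have cE s : linked_twist x0 x1 y0 y1 j k (c s) = c (full_shift s).
  exact: coding_equivariant.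
have hT := @torus_hausdorff R; have cpt := full_shift_space_compact N.
exists (range c); split.
- by move=> _ [s _ <-]; exact: coding_in_annuli.
- apply/seteqP; split=> [_ [_ [s _ <-] <-]|_ [s _ <-]].
    by exists (full_shift s).
  have [t <-] := full_shift_surjective _ s.
  by exists (c t); [exists t|exact: cE].
- split.
  + by exists (c (fun=> Ordinal (ltnW N1))); exists (fun=> Ordinal (ltnW N1)).
  + exact: compact_range.
  + by apply: perfect_range => //; exact: full_shift_space_perfect.
  + by apply: totally_disconnected_range => //; exact: full_shift_space_zero_dimensional.
have [g ghomeo [toK gK]] := to_range_homeomorphism c cpt hT cI cC.
exists (to_range c \o @full_shift N \o g); split.
  by move=> y; rewrite /= -cE; congr (linked_twist _ _ _ _ _ _ _); rewrite -[y in RHS]gK.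
by exists g; split=> //; apply/funext => y /=; rewrite toK.
Qed.
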